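(* Let $\mathbb{X}$ be a complex Banach space and let $T\in\mathcal{G}_1(\mathbb{X})$ (respectively, $T\in\mathcal{G}_2(\mathbb{X})$) be arbitrary. Then the function $A_T(x)=(\|x\|^2-\|Tx\|^2)^{1/2}$, $x\in\mathbb{X}$, defines a norm (respectively, a semi-norm) on $\mathbb{X}$ if and only if $T$ dilates to an isometry on a normed space (respectively, a semi-normed linear space).
   Context: Let $M_T=\{x\in\mathbb{X}:\|x\|=1,\ \|Tx\|=\|T\|\}$. $\mathcal{G}_1(\mathbb{X})=\{T\in\mathcal{B}(\mathbb{X}):\|T\|=1,\ M_T=\emptyset\}$ and $\mathcal{G}_2(\mathbb{X})=\{T\in\mathcal{B}(\mathbb{X}):\|T\|=1,\ M_T\ne\emptyset\}$. A semi-norm on a vector space is a function $N\ge 0$ with $N(\alpha v)=|\alpha|N(v)$ and $N(v+w)\le N(v)+N(w)$. $T$ dilates to an isometry $V$ on a normed (semi-normed) linear space $\widetilde{\mathbb{X}}$, where $V:\widetilde{\mathbb{X}}\to\widetilde{\mathbb{X}}$ is linear and preserves the norm (semi-norm), if there are a linear (semi-)norm-preserving map $W:\mathbb{X}\to\widetilde{\mathbb{X}}$ and a linear subspace $\mathbb{L}\subseteq\widetilde{\mathbb{X}}$ (closed, in the normed case) such that $\widetilde{\mathbb{X}}=W(\mathbb{X})\oplus_2\mathbb{L}$ (every $u$ is uniquely $u=w+l$ with $w\in W(\mathbb{X})$, $l\in\mathbb{L}$, and $\|u\|^2=\|w\|^2+\|l\|^2$) and, with $\widehat{W}:=W:\mathbb{X}\to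 W(\mathbb{X})$ and $\widehat{T}:=\widehat{W}T\widehat{W}^{-1}$, one has $q(\widehat{T})=P_{W(\mathbb{X})}\,q(V)|_{W(\mathbb{X})}$ for all $q\in\mathbb{C}[z]$, where $P_{W(\mathbb{X})}(w+l)=w$. *)

(* Defs.v *)
From mathcomp Require Import all_boot all_order all_algebra.
From mathcomp Require Import complex.
From mathcomp Require Import boolp classical_sets functions reals topology normedtype.
Set Implicit Arguments.
Unset Strict Implicit.
Unset Printing Implicit Defensive.
Import Order.TTheory GRing.Theory Num.Theory.
Import numFieldNormedType.Exports.
Local Open Scope classical_set_scope.
Local Open Scope ring_scope.
Local Open Scope complex_scope.

(* The norm of a normed module over R[i] takes its values in R[i] (on the
   nonnegative real axis); [rnorm] is the same norm as an element of R. *)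
Definition rnorm (R : realType) (E : normedModType R[i]) (x : E) : R :=
  complex.Re `|x|.

Definition is_seminorm (R : realType) (E : lmodType R[i]) (N : E -> R) : Prop :=
  [/\ forall v, 0 <= N v,
      forall (a : R[i]) v, N (a *: v) = complex.Re `|a| * N v
    & forall v w, N (v + w) <= N v + N w].

Definition is_norm (R : realType) (E : lmodType R[i]) (N : E -> R) : Prop :=
  is_seminorm N /\ forall v, N v = 0 -> v = 0.

Definition opnorm (R : realType) (X : normedModType R[i])
    (T : {linear X -> X}) : R :=
  sup [set rnorm (T x) | x in [set x : X | rnorm x <= 1]].

Definition norm_attainment (R : realType) (X : normedModType R[i])
    (T : {linear X -> X}) : set X :=
  [set x | rnorm x = 1 /\ rnorm (T x) = opnorm T].

(* [bounded_near T (nbhs 0)] is the library's boundedness of a linear map. *)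
Definition classG1 (R : realType) (X : normedModType R[i])
    (T : {linear X -> X}) : Prop :=
  [/\ bounded_near T (nbhs (0 : X)), opnorm T = 1 & norm_attainment T = set0].

Definition classG2 (R : realType) (X : normedModType R[i])
    (T : {linear X -> X}) : Prop :=
  [/\ bounded_near T (nbhs (0 : X)), opnorm T = 1 & norm_attainment T !=set0].

Definition defect (R : realType) (X : normedModType R[i])
    (T : {linear X -> X}) (x : X) : R :=
  Num.sqrt (rnorm x ^+ 2 - rnorm (T x) ^+ 2).

(* q(f) = q_0 I + q_1 f + ... + q_d f^d, applied to u *)
Definition poly_op (R : realType) (E : lmodType R[i]) (q : {poly R[i]})
    (f : E -> E) (u : E) : E :=
  \sum_(i < size q) q`_i *: iter i f u.

Definition linear_subspace (R : realType) (E : lmodType R[i]) (L : set E) :=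
  submod_closed [pred u | u \in L].

(* E = A (+)_2 L for the (semi-)norm N *)
Definition l2_sum (R : realType) (E : lmodType R[i]) (N : E -> R)
    (A L : set E) : Prop :=
  (forall u, exists! wl : E * E, [/\ A wl.1, L wl.2 & u = wl.1 + wl.2]) /\
  (forall w l, A w -> L l -> N (w + l) ^+ 2 = N w ^+ 2 + N l ^+ 2).

(* The projection w + l |-> w along L; it is determined as soon as A and L
   are complementary, as in [l2_sum]. *)
Definition proj_along (R : realType) (E : lmodType R[i]) (A L : set E)
    (u : E) : E :=
  xget 0 [set w | A w /\ exists2 l, L l & u = w + l].

(* That = What T What^-1. It is meaningful on the range of W only, where
   ['pinv_(fun=> 0) setT W] inverts the injective map W. *)
Definition transport (R : realType) (X E : lmodType R[i])
    (W : X -> E) (T : X -> X) : E -> E :=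
  W \o T \o 'pinv_(fun=> 0) [set: X] W.

Definition dilation (R : realType) (X : normedModType R[i])
    (T : {linear X -> X}) (E : lmodType R[i]) (N : E -> R)
    (V : {linear E -> E}) (W : {linear X -> E}) (L : set E) : Prop :=
  [/\ forall u, N (V u) = N u,
      forall x, N (W x) = rnorm x,
      linear_subspace L,
      l2_sum N (range W) L
    & forall (q : {poly R[i]}) w, range W w ->
        poly_op q (transport W T) w = proj_along (range W) L (poly_op q V w)].

Definition dilates_normed (R : realType) (X : normedModType R[i])
    (T : {linear X -> X}) : Prop :=
  exists (E : normedModType R[i]) (V : {linear E -> E}) (W : {linear X -> E})
      (L : set E),
    closed L /\ dilation T (@rnorm R E) V W L.

Definition dilates_seminormed (R : realType) (X : normedModType R[i])
    (T : {linear X -> X}) : Prop :=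
  exists (E : lmodType R[i]) (N : E -> R) (V : {linear E -> E})
      (W : {linear X -> E}) (L : set E),
    is_seminorm N /\ dilation T N V W L.

(* Main.v *)
(** If [V] is an isometric dilation of [T] with embedding [W], then
    [V (W x)] is [W (T x)] plus the vector [D x := V (W x) - W (T x)] of [L], so
    by orthogonality [A_T x = N (D x)], which is a semi-norm because [D] is
    linear; it is a norm when [T] attains its norm nowhere, since [A_T x = 0]
    means [`|T x| = `|x|].

    Conversely, if [A_T] is a (semi-)norm, the shift
    [(u_0, u_1, u_2, ...) |-> (T u_0, u_0, u_1, ...)] dilates [T] on the
    finitely supported sequences in [X], where [u_0] is measured by the norm of
    [X], every other entry by [A_T], and the entries are combined in the l2 way.
    It is isometric because [`|T u_0|^2 + A_T(u_0)^2 = `|u_0|^2]. *)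
Require Import Defs.
From HB Require Import structures.
From mathcomp Require Import all_boot all_order all_algebra.
From mathcomp Require Import complex.
From mathcomp Require Import boolp classical_sets functions reals topology normedtype.
Set Implicit Arguments.
Unset Strict Implicit.
Unset Printing Implicit Defensive.
Import Order.TTheory GRing.Theory Num.Theory.
Import numFieldNormedType.Exports.
Local Open Scope classical_set_scope.
Local Open Scope ring_scope.
Local Open Scope complex_scope.

(** * The real-valued norm, and contractivity of operators of norm one *)

Section Rnorm.
Variables (R : realType) (E : normedModType R[i]).
Implicit Types x y : E.

Lemma normE_rnorm x : `|x| = (rnorm x)%:C.
Proof. by rewrite /rnorm RRe_real// ger0_real. Qed.

Lemma rnorm_ge0 x : 0 <= rnorm x.
Proof. by rewrite -ler0c -normE_rnorm. Qed.

Lemma is_norm_rnorm : is_norm (@rnorm R E).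
Proof.
split; last by move=> v v0; apply/normr0_eq0; rewrite normE_rnorm v0.
split=> [v|a v|v w]; first exact: rnorm_ge0.
- by rewrite /rnorm normrZ normc_def [`|v|]normE_rnorm -rmorphM.
- by rewrite -lecR rmorphD/= -!normE_rnorm ler_normD.
Qed.

Lemma rnorm_divZ x y : rnorm ((rnorm x)^-1%:C *: y) = (rnorm x)^-1 * rnorm y.
Proof.
have [[_ nZ _] _] := is_norm_rnorm.
by rewrite nZ normc_def/= expr0n addr0 sqrtr_sqr ger0_norm// invr_ge0 rnorm_ge0.
Qed.

Lemma opnorm1_contraction (T : {linear E -> E}) x :
  opnorm T = 1 -> rnorm (T x) <= rnorm x.
Proof.
have [_ n0] := is_norm_rnorm.
move=> T1; have [x0|x0] := eqVneq (rnorm x) 0.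
  by rewrite (n0 _ x0) linear0.
(* [sup] takes the default value 0 on a set without a supremum, so [opnorm T = 1] already makes the
   image of the unit ball bounded. *)
have hs : has_sup [set rnorm (T y) | y in [set y : E | rnorm y <= 1]].
  apply: contra_eqP T1 => /sup_out; rewrite /opnorm => ->.
  by rewrite eq_sym oner_eq0.
have xgt0 : 0 < rnorm x by rewrite lt0r x0 rnorm_ge0.
have : rnorm (T ((rnorm x)^-1%:C *: x)) <= 1.
  rewrite -T1; apply: sup_upper_bound => //.
  by exists ((rnorm x)^-1%:C *: x) => //=; rewrite rnorm_divZ mulVf.
by rewrite linearZ/= rnorm_divZ -ler_pdivlMl ?invr_gt0// invrK mulr1.
Qed.

End Rnorm.

(** * Semi-norms, projections along a complement, closed zero sets *)

Section Seminorm.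
Variables (R : realType) (E : lmodType R[i]) (N : E -> R).
Hypothesis hN : is_seminorm N.

Lemma seminorm0 : N 0 = 0.
Proof. by have [_ NZ _] := hN; rewrite -(scale0r 0) NZ normr0 mul0r. Qed.

End Seminorm.

Lemma proj_alongE (R : realType) (E : lmodType R[i]) (N : E -> R)
    (A L : set E) (w l : E) :
  l2_sum N A L -> A w -> L l -> proj_along A L (w + l) = w.
Proof.
move=> [dec _] Aw Ll; apply: xget_unique; first by split=> //; exists l.
move=> y [Ay [m Lm e]].
have [wl [_ uniq_wl]] := dec (w + l).
have h1 := uniq_wl (w, l) (And3 Aw Ll erefl).
have h2 := uniq_wl (y, m) (And3 Ay Lm e).
by have := etrans (esym h2) h1; case.
Qed.

Lemma closed_lipschitz_zeros (K : numFieldType) (E F : normedModType K)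
    (f : E -> F) :
  (forall u v, `|f u - f v| <= `|u - v|) -> closed [set u | f u = 0].
Proof.
move=> f_lip; have f_cont : continuous f.
  move=> u; apply/cvgrPdist_lt => e e0; near=> v.
  by apply: le_lt_trans (f_lip _ _) _; near: v; exact: cvgr_dist_lt.
have -> : [set u | f u = 0] = f @^-1` [set 0] by [].
apply: preimage_closed => [u _|]; first exact: f_cont.
exact: accessible_closed_set1 (hausdorff_accessible (@norm_hausdorff _ F)) 0.
Unshelve. all: by end_near. Qed.

(** * The vector space of finitely supported sequences *)

Section FiniteSequences.
Variables (K : pzRingType) (X : lmodType K).

Definition finitely_supported : {pred nat -> X} :=
  fun u => `[< exists n, forall m, (n <= m)%N -> u m = 0 >].

Lemma finitely_supported_submod : submod_closed finitely_supported.
Proof.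
split; first by apply/asboolP; exists 0%N.
move=> a u v /asboolP[n hn] /asboolP[m hm]; apply/asboolP; exists (maxn n m) => k.
by rewrite geq_max => /andP[nk mk]; rewrite !fctE hn// hm// scaler0 addr0.
Qed.

HB.instance Definition _ :=
  GRing.isSubmodClosed.Build K (nat -> X) finitely_supported
    finitely_supported_submod.

Record finseq := Finseq {
  finseq_val :> nat -> X; _ : finseq_val \in finitely_supported }.

HB.instance Definition _ := [isSub for finseq_val].
HB.instance Definition _ := [Choice of finseq by <:].
HB.instance Definition _ := [SubChoice_isSubLmodule of finseq by <:].

Lemma finseq_support (u : finseq) : exists n, forall m, (n <= m)%N -> u m = 0.
Proof. by case: u => u /= /asboolP. Qed.

Lemma finseqP (u v : finseq) : (forall i, u i = v i) -> u = v.
Proof. by move=> uv; apply/val_inj/funext. Qed.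

Lemma finseqD (u v : finseq) i : (u + v) i = u i + v i.
Proof. by []. Qed.

Lemma finseqB (u v : finseq) i : (u - v) i = u i - v i.
Proof. by []. Qed.

Lemma finseqZ a (u : finseq) i : (a *: u) i = a *: u i.
Proof. by []. Qed.

Lemma finseq_sum n (F : 'I_n -> finseq) i : (\sum_k F k) i = \sum_k F k i.
Proof. by elim/big_ind2: _ => // u x v y <- <-. Qed.

End FiniteSequences.

(** * The l2 combination of a family of semi-norms *)

Section L2Norm.
Variables (R : realType) (X : lmodType R[i]) (p : nat -> X -> R).
Implicit Types u v : finseq X.

(** Cutting the sum at a bound of the support picked by [cid] keeps it finite; by [l2normE] every
    other bound gives the same value. *)
Definition l2norm u : R :=
  Num.sqrt (\sum_(i < projT1 (cid (finseq_support u))) p i (u i) ^+ 2).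

Hypothesis hp : forall i, is_seminorm (p i).

Lemma l2normE u n : (forall m, (n <= m)%N -> u m = 0) ->
  l2norm u = Num.sqrt (\sum_(i < n) p i (u i) ^+ 2).
Proof.
(* Past a bound of the support every term is [p i 0 = 0]; two bounds are then compared through their
   maximum. *)
have tail k m : (forall j, (k <= j)%N -> u j = 0) -> (k <= m)%N ->
    \sum_(i < m) p i (u i) ^+ 2 = \sum_(i < k) p i (u i) ^+ 2.
  move=> uk km.
  rewrite -!(big_mkord xpredT (fun i => p i (u i) ^+ 2)).
  rewrite (big_cat_nat (n := k))//= [X in _ + X]big_nat_cond.
  rewrite [X in _ + X]big1 ?addr0// => i.
  by rewrite andbT => /andP[ki _]; rewrite uk// (seminorm0 (hp i)) expr0n.
rewrite /l2norm; case: cid => k uk /= un; congr Num.sqrt.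
by rewrite -(tail _ _ uk (leq_maxl k n)) -(tail _ _ un (leq_maxr k n)).
Qed.

Lemma l2norm_sqr u n : (forall m, (n <= m)%N -> u m = 0) ->
  l2norm u ^+ 2 = \sum_(i < n) p i (u i) ^+ 2.
Proof.
by move=> /l2normE ->; rewrite sqr_sqrtr// sumr_ge0// => i _; rewrite sqr_ge0.
Qed.

(* The triangle inequality of the modulus, applied to [a + i c] and [b + i d]. *)
Lemma sqrt_sqrD_triangle (a b c d : R) :
  Num.sqrt ((a + b) ^+ 2 + (c + d) ^+ 2) <=
  Num.sqrt (a ^+ 2 + c ^+ 2) + Num.sqrt (b ^+ 2 + d ^+ 2).
Proof.
by have := ler_normD (a +i* c) (b +i* d); rewrite !normc_def -rmorphD/= lecR.
Qed.

Lemma is_seminorm_l2norm : is_seminorm l2norm.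
Proof.
split=> [u|a u|u v]; first exact: sqrtr_ge0.
- have [n un] := finseq_support u.
  rewrite (l2normE un) (@l2normE (a *: u) n); last first.
    by move=> m nm; rewrite finseqZ un// scaler0.
  rewrite (eq_bigr (fun i : 'I_n => complex.Re `|a| ^+ 2 * p i (u i) ^+ 2)).
    rewrite -mulr_sumr sqrtrM ?sqr_ge0// sqrtr_sqr ger0_norm//.
    by rewrite -ler0c RRe_real// ger0_real.
  by move=> i _; have [_ pZ _] := hp i; rewrite finseqZ pZ exprMn.
- have [n un] := finseq_support u; have [m vm] := finseq_support v.
  have un' k : (maxn n m <= k)%N -> u k = 0.
    by rewrite geq_max => /andP[/un].
  have vm' k : (maxn n m <= k)%N -> v k = 0.
    by rewrite geq_max => /andP[_ /vm].
  rewrite (l2normE un') (l2normE vm') (@l2normE (u + v) (maxn n m)); last first.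
    by move=> k nk; rewrite finseqD un'// vm'// addr0.
  (* Minkowski by induction on the length: each step is the planar triangle inequality for the pair
     formed by the root of the first [k] terms and the value at entry [k]. *)
  elim: (maxn n m) => [|k IH]; first by rewrite !big_ord0 sqrtr0 addr0.
  have sum_ge0 (w : nat -> X) : 0 <= \sum_(i < k) p i (w i) ^+ 2.
    by apply: sumr_ge0 => i _; rewrite sqr_ge0.
  rewrite !big_ord_recr /= -(sqr_sqrtr (sum_ge0 (u + v))).
  rewrite -(sqr_sqrtr (sum_ge0 u)) -(sqr_sqrtr (sum_ge0 v)).
  apply: le_trans (sqrt_sqrD_triangle _ _ _ _).
  have [p0 _ pD] := hp k.
  apply: ler_wsqrtr.
  by rewrite lerD// lerXn2r ?nnegrE ?addr_ge0 ?sqrtr_ge0 ?p0// pD.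
Qed.

(** Used twice: for the definiteness of [l2norm], and for the continuity of the zeroth
    coordinate. *)
Lemma le_l2norm u i : p i (u i) <= l2norm u.
Proof.
have [n un] := finseq_support u.
(* The bound is pushed past [i] so that entry [i] is one of the summands. *)
have un' m : (maxn n i.+1 <= m)%N -> u m = 0 by rewrite geq_max => /andP[/un].
rewrite (l2normE un') -[leLHS]ger0_norm; last by have [p0 _ _] := hp i.
rewrite -sqrtr_sqr ler_wsqrtr//.
rewrite (bigD1 (Ordinal (leq_maxr n i.+1)))//= lerDl.
by apply: sumr_ge0 => j _; rewrite sqr_ge0.
Qed.

Lemma l2norm_eq0 : (forall i x, p i x = 0 -> x = 0) ->
  forall u, l2norm u = 0 -> u = 0.
Proof.
move=> p_def u u0; apply: finseqP => i; apply: (p_def i).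
have [p0 _ _] := hp i; apply/le_anti; rewrite p0 andbT -u0.
exact: le_l2norm.
Qed.

End L2Norm.

(** * The normed space obtained when all weights are norms *)

Section L2Space.
Variables (R : realType) (X : lmodType R[i]) (p : nat -> X -> R).

(** A copy of [finseq X] indexed by the proof that the weights are norms, so that each family [p]
    gets its own normed structure on the same sequences. *)
Definition l2space of forall i, is_norm (p i) : Type := finseq X.

Hypothesis hp : forall i, is_norm (p i).

HB.instance Definition _ := GRing.Lmodule.on (l2space hp).

Let p_seminorm i : is_seminorm (p i) := proj1 (hp i).

Definition l2space_norm (u : l2space hp) : R[i] := (l2norm p u)%:C.

Let normD u v : l2space_norm (u + v) <= l2space_norm u + l2space_norm v.
Proof.
by have [_ _ h] := is_seminorm_l2norm p_seminorm; rewrite -rmorphD lecR; apply: h.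
Qed.

Let normZ a u : l2space_norm (a *: u) = `|a| * l2space_norm u.
Proof.
have [_ h _] := is_seminorm_l2norm p_seminorm.
by rewrite normc_def -rmorphM; congr (_%:C); rewrite h normc_def.
Qed.

Let norm_eq0 u : l2space_norm u = 0 -> u = 0.
Proof.
by move=> /complexI; apply: l2norm_eq0 => // i; have [] := hp i.
Qed.

HB.instance Definition _ :=
  Lmodule_isNormed.Build R[i] (l2space hp) normD normZ norm_eq0.

End L2Space.

(** * The defect function and the transported operator *)

Section Dilation.
Variables (R : realType) (X : normedModType R[i]) (T : {linear X -> X}).

(** Contractivity makes the radicand nonnegative, so the default value of [Num.sqrt] on negative
    numbers does not occur. *)
Lemma defect_sqr x : opnorm T = 1 ->
  defect T x ^+ 2 = rnorm x ^+ 2 - rnorm (T x) ^+ 2.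
Proof.
move=> T1; rewrite sqr_sqrtr// subr_ge0 lerXn2r ?nnegrE ?rnorm_ge0//.
exact: opnorm1_contraction.
Qed.

Lemma transportE (E : lmodType R[i]) (W : X -> E) : injective W ->
  forall x, transport W T (W x) = W (T x).
Proof.
move=> Winj x; rewrite /transport/= pinvKV ?inE// => ? ? _ _; exact: Winj.
Qed.

(** * From a dilation to the (semi-)norm property of the defect *)

Section DefectOfDilation.
Variables (E : lmodType R[i]) (N : E -> R) (V : {linear E -> E}).
Variables (W : {linear X -> E}) (L : set E).
Hypotheses (N_seminorm : is_seminorm N)
  (dil : dilation T N V W L).

(** [N] may vanish on nonzero vectors of [E], but along [W] it is the norm of [X], which is
    definite. *)
Lemma dilation_inj : injective W.
Proof.
have [_ NW _ _ _] := dil; have [_ n0] := is_norm_rnorm X.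
move=> x y Wxy; apply/eqP; rewrite -subr_eq0; apply/eqP/n0.
by rewrite -NW linearB/= Wxy subrr (seminorm0 N_seminorm).
Qed.

Lemma dilation_mem x : L (V (W x) - W (T x)).
Proof.
have [_ _ _ dec compress] := dil.
have [[w l] [[/= Aw Ll wl] _]] := dec.1 (V (W x)).
have poly_opX (f : E -> E) u : poly_op 'X f u = f u.
  rewrite /poly_op size_polyX 2!big_ord_recl big_ord0 !coefX/=.
  by rewrite scale0r scale1r add0r addr0.
(* At [q = 'X] the compression identity says that the component of [V (W x)] in [range W] is
   [W (T x)]; what remains is its component [l] in [L]. *)
have := compress 'X (W x) (ex_intro2 _ _ x I erefl).
rewrite !poly_opX (transportE dilation_inj) wl (proj_alongE dec Aw Ll) => ->.
by rewrite addrC addKr.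
Qed.

Lemma defect_dilation x : defect T x = N (V (W x) - W (T x)).
Proof.
have [NV NW _ [_ pyth] _] := dil; have [N0 _ _] := N_seminorm.
have VWx : V (W x) = W (T x) + (V (W x) - W (T x)) by rewrite addrC subrK.
rewrite /defect -NW -NV {1}VWx pyth; last 2 first.
- by exists (T x).
- exact: dilation_mem.
by rewrite NW addrAC subrr add0r sqrtr_sqr ger0_norm.
Qed.

Lemma is_seminorm_defect : is_seminorm (defect T).
Proof.
have [N0 NZ ND] := N_seminorm.
split=> [x|a x|x y]; rewrite !defect_dilation ?N0//.
- by rewrite -NZ scalerBr !(linearZ_LR W, linearZ_LR V, linearZ_LR T).
- by rewrite (linearD T) !(linearD W) (linearD V) opprD addrACA ND.
Qed.

End DefectOfDilation.

(** A nonzero vector of zero defect, once normalised, would attain the norm of [T]. *)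
Lemma defect_eq0 : opnorm T = 1 -> norm_attainment T = set0 ->
  forall x, defect T x = 0 -> x = 0.
Proof.
move=> T1 MT x dx; have [_ n0] := is_norm_rnorm X.
apply: contrapT => /eqP x0; have nx0 : rnorm x != 0.
  by apply: contra_neq x0 => /n0.
have Tx : rnorm (T x) = rnorm x.
  apply/esym/eqP; rewrite -(eqrXn2 (n := 2)) ?rnorm_ge0// -subr_eq0.
  by rewrite -defect_sqr// dx expr0n.
suff : norm_attainment T ((rnorm x)^-1%:C *: x) by rewrite MT.
by split; rewrite ?linearZ/= rnorm_divZ ?Tx ?mulVf.
Qed.

(** * From the defect to a dilation: the shift *)

Section Shift.
Notation S := (finseq X).

Definition shift_fun (u : S) (i : nat) : X := if i is j.+1 then u j else T (u 0%N).

Lemma shift_fun_subproof u : shift_fun u \in @finitely_supported _ X.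
Proof.
have [n un] := finseq_support u; apply/asboolP; exists n.+1.
by case=> // m nm; apply: un.
Qed.

Definition shift (u : S) : S := Finseq (shift_fun_subproof u).

Lemma shift_linear : linear shift.
Proof.
move=> a u v; apply: finseqP; case=> [|i]; rewrite finseqD finseqZ //.
exact: (linearP T).
Qed.

HB.instance Definition _ := GRing.isLinear.Build R[i] S S _ shift shift_linear.

Definition single_fun (x : X) (i : nat) : X := if i is 0%N then x else 0.

Lemma single_fun_subproof x : single_fun x \in @finitely_supported _ X.
Proof. by apply/asboolP; exists 1%N; case. Qed.

Definition single (x : X) : S := Finseq (single_fun_subproof x).

Lemma single_linear : linear single.
Proof.
move=> a x y; apply: finseqP; case=> [|i] //.
by rewrite finseqD finseqZ/= scaler0 addr0.
Qed.

HB.instance Definition _ := GRing.isLinear.Build R[i] X S _ single single_linear.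

Lemma single_inj : injective single.
Proof. by move=> x y /(congr1 (fun u : S => u 0%N)). Qed.

Definition defect_weight (i : nat) : X -> R :=
  if i is 0%N then @rnorm R X else defect T.

(** The complement [L] of the embedded copy [range single] of [X]. *)
Definition headless : set S := [set u | u 0%N = 0].

Hypotheses (T1 : opnorm T = 1) (hT : is_seminorm (defect T)).

Lemma is_seminorm_weight i : is_seminorm (defect_weight i).
Proof. by case: i => //=; have [] := is_norm_rnorm X. Qed.

Let N := l2norm defect_weight.

Let N_sqr := l2norm_sqr is_seminorm_weight.

Let N_ge0 u : 0 <= N u.
Proof. exact: sqrtr_ge0. Qed.

Lemma l2norm_shift u : N (shift u) = N u.
Proof.
have [n un] := finseq_support u.
(* The bound [n.+1] ensures that entry 0 is in the sum even when [n = 0]; the shift then needs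
   [n.+2]. *)
have un1 m : (n.+1 <= m)%N -> u m = 0 by move=> /ltnW/un.
apply/eqP; rewrite -(eqrXn2 (n := 2))//; apply/eqP.
rewrite (N_sqr un1) (@N_sqr _ n.+2); last by case.
(* Entries 0 and 1 of [shift u] together contribute the squared norm of [u 0]; the later terms agree
   one by one. *)
rewrite 2!big_ord_recl [RHS]big_ord_recl/= defect_sqr// addrA.
rewrite [X in X + _ = _]addrC subrK; congr (_ + _).
Qed.

Lemma l2norm_single x : N (single x) = rnorm x.
Proof.
apply/eqP; rewrite -(eqrXn2 (n := 2)) ?rnorm_ge0//; apply/eqP.
by rewrite (@N_sqr _ 1%N) ?big_ord1//; case.
Qed.

Lemma headless_submod : linear_subspace headless.
Proof.
split; first by rewrite inE.
move=> a u v; rewrite !inE => u0 v0; rewrite /headless /mkset.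
by rewrite finseqD finseqZ u0 v0 scaler0 addr0.
Qed.

Lemma sub_single_headless (u : S) : headless (u - single (u 0%N)).
Proof. by rewrite /headless /mkset finseqB subrr. Qed.

(** The two summands live on disjoint sets of indices, entry 0 and the rest, so the sum of squares
    splits. *)
Lemma l2_sum_single : l2_sum N (range single) headless.
Proof.
split=> [u|_ l [x _ <-] l0].
  exists (single (u 0%N), u - single (u 0%N)); split=> [|[_ l]/= [[x _ <-] l0 ->]].
    split=> /=; first by exists (u 0%N).
      exact: sub_single_headless.
    by rewrite addrC subrK.
  by rewrite finseqD l0 addr0/= [single x + l]addrC addrK.
have [n ln] := finseq_support l.
have ln1 m : (n.+1 <= m)%N -> l m = 0 by move=> /ltnW/ln.
rewrite l2norm_single (N_sqr ln1) (@N_sqr _ n.+1); last first.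
  by case=> // m nm; rewrite finseqD ln1// addr0.
rewrite !big_ord_recl finseqD l0 addr0.
rewrite [defect_weight _ 0](seminorm0 (is_seminorm_weight 0)).
rewrite expr0n add0r; congr (_ + _).
by apply: eq_bigr => i _; rewrite finseqD add0r.
Qed.

Lemma dilation_shift : dilation T N shift single headless.
Proof.
split.
- exact: l2norm_shift.
- exact: l2norm_single.
- exact: headless_submod.
- exact: l2_sum_single.
- move=> q _ [x _ <-].
  have iterT n : iter n (transport single T) (single x) = single (iter n T x).
    by elim: n => //= n ->; rewrite (transportE single_inj).
  (* Entry 0 of [shift u] is [T (u 0)], so entry 0 evolves under [T] alone. *)
  have iterS n : iter n shift (single x) 0%N = iter n T x.
    by elim: n => //= n ->.
  set u := poly_op q shift (single x).
  (* Projecting onto [range single] keeps only entry 0, which for [u] is [q] of [T] applied to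
     [x]. *)
  rewrite -[u](subrK (single (u 0%N))) addrC (proj_alongE l2_sum_single).
  + rewrite /poly_op; under eq_bigr do rewrite iterT -linearZ.
    rewrite -linear_sum finseq_sum; congr single.
    by apply: eq_bigr => i _; rewrite finseqZ iterS.
  + by exists (u 0%N).
  + exact: sub_single_headless.
Qed.

Lemma dilates_seminormed_defect : dilates_seminormed T.
Proof.
exists S, N, shift, single, headless; split; last exact: dilation_shift.
exact: is_seminorm_l2norm is_seminorm_weight.
Qed.

End Shift.

(** * The normed case and the equivalence *)

Lemma is_norm_weight : is_norm (defect T) -> forall i, is_norm (defect_weight i).
Proof. by move=> hT; case=> //=; apply: is_norm_rnorm. Qed.

Lemma dilates_normed_defect : opnorm T = 1 -> is_norm (defect T) ->
  dilates_normed T.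
Proof.
move=> T1 hT; pose E : normedModType R[i] := l2space (is_norm_weight hT).
(* [rnorm] on [E] computes to [l2norm] with the defect weights, so the dilation already built
   applies and closedness of [headless] remains. *)
exists E, shift, single, headless; split; last exact: dilation_shift T1 hT.1.
(* [headless] is the zero set of this coordinate map, which is 1-Lipschitz because the zeroth weight
   is the norm of [X]. *)
pose head (u : E) : X := (u : finseq X) 0%N.
have head_lip (u v : E) : `|head u - head v| <= `|u - v|.
  have -> : head u - head v = head (u - v) by rewrite /head finseqB.
  rewrite normE_rnorm lecR.
  exact: (le_l2norm (fun i => (is_norm_weight hT i).1) _ 0%N).
exact: closed_lipschitz_zeros head_lip.
Qed.

End Dilation.

Theorem theorem7p26 (R : realType) (X : completeNormedModType R[i])
    (T : {linear X -> X}) :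
  (classG1 T -> (is_norm (defect T) <-> dilates_normed T)) /\
  (classG2 T -> (is_seminorm (defect T) <-> dilates_seminormed T)).
Proof.
split=> [[_ T1 MT]|[_ T1 _]]; split.
- exact: dilates_normed_defect.
- move=> [E [V [W [L [_ dil]]]]]; split; last exact: defect_eq0.
  exact: is_seminorm_defect (is_norm_rnorm E).1 dil.
- exact: dilates_seminormed_defect.
- by move=> [E [N [V [W [L [hN dil]]]]]]; exact: is_seminorm_defect hN dil.
Qed.
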